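(* Consider the linear time-varying system $$\xi_{k+1}=A_k\xi_k+B_kw_k,\qquad k=0,1,2,\dots,$$ with state $\xi_k\in\mathbb{R}^{2p}$, input $w_k\in\mathbb{R}^p$, $A_k\in\mathbb{R}^{2p\times2p}$, $B_k\in\mathbb{R}^{2p\times p}$. Let $L>0$, let $\{\beta_k\}$ be a real sequence, and let $M_k:=\tilde M_k\otimes I_p$, $N_k:=\tilde N_k\otimes I_p$, where $$\tilde M_k:=\begin{bmatrix}0&0&-\frac12\beta_k\\ 0&0&\frac12\beta_k\\ -\frac12\beta_k&\frac12\beta_k&\frac1{2L}\end{bmatrix},\qquad \tilde N_k:=\begin{bmatrix}0&0&-\frac12(1+\beta_k)\\ 0&0&\frac12\beta_k\\ -\frac12(1+\beta_k)&\frac12\beta_k&\frac1{2L}\end{bmatrix}.$$ If there exist matrices $\{P_k\}$ with $P_k\ge0$ and a nondecreasing sequence of nonnegative scalars $\{\mu_k\}$ such that, for all $k$, $$\begin{bmatrix}A_k^{\top}P_{k+1}A_k-P_k&A_k^{\top}P_{k+1}B_k\\ B_k^{\top}P_{k+1}A_k&B_k^{\top}P_{k+1}B_k\end{bmatrix}-\mu_kM_k-(\mu_{k+1}-\mu_k)N_k\le0,$$ then for all trajectories and all $k$, $$V_{k+1}(\xi_{k+1})-V_k(\xi_k)\le S_k(\xi_k,w_k),$$ with the storage function $V_k(\xi_k):=\xi_k^{\top}P_k\xi_k$ and the supply rate $$S_k(\xi_k,w_k):=\begin{bmatrix}\xi_k\\ w_k\end{bmatrix}^{\top}X_k\begin{bmatrix}\xi_k\\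 w_k\end{bmatrix},\qquad X_k:=\mu_kM_k+(\mu_{k+1}-\mu_k)N_k.$$ In addition, let $f:\mathbb{R}^p\to\mathbb{R}$ be differentiable, let $x_\star$ satisfy $\nabla f(x_\star)=0$, and put $f_\star:=f(x_\star)$. If, along a trajectory with associated iterates $\{x_k\}\subset\mathbb{R}^p$, this supply rate satisfies $$S_k(\xi_k,w_k)\le\mu_k(f(x_k)-f_\star)-\mu_{k+1}(f(x_{k+1})-f_\star)\quad\text{for all }k,$$ then $$f(x_k)-f_\star\le\frac{\mu_0(f(x_0)-f_\star)+V_0(\xi_0)}{\mu_k}$$ for all $k$ with $\mu_k>0$.
   Context: Matrix inequalities $\ge 0$, $\le 0$ are between symmetric matrices in the semidefinite sense; $P_k\in\mathbb{R}^{2p\times 2p}$. $I_p$ is the $p\times p$ identity and $\otimes$ is the Kronecker product. A trajectory is a pair of sequences $(\xi_k)_{k\ge0}$, $(w_k)_{k\ge0}$ satisfying the system recursion. In the paper's application (Nesterov's method), $\xi_k=\begin{bmatrix}(x_k-x_\star)^{\top}&(x_{k-1}-x_\star)^{\top}\end{bmatrix}^{\top}$ where $x_k$ are the iterates. *)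

(* Defs.v *)
From HB Require Import structures.
From mathcomp Require Import all_boot all_order all_algebra.
From mathcomp Require Import mxtens.
From mathcomp Require Import all_classical all_reals all_analysis.

Set Implicit Arguments.
Unset Strict Implicit.
Unset Printing Implicit Defensive.

Import Order.TTheory GRing.Theory Num.Theory.
Import numFieldNormedType.Exports.

Local Open Scope ring_scope.

Definition qform (R : realType) (n : nat) (A : 'M[R]_n) (x : 'cV[R]_n) : R :=
  (x^T *m A *m x) ord0 ord0.

(* Semidefiniteness includes symmetry. *)
Definition psdmx (R : realType) (n : nat) (A : 'M[R]_n) : Prop :=
  A \is symmetricmx /\ forall x : 'cV[R]_n, 0 <= qform A x.

Definition nsdmx (R : realType) (n : nat) (A : 'M[R]_n) : Prop :=
  A \is symmetricmx /\ forall x : 'cV[R]_n, qform A x <= 0.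

Definition gradient (R : realType) (p : nat) (f : 'cV[R]_p -> R)
    (x : 'cV[R]_p) : 'cV[R]_p :=
  \col_(i < p) 'D_(delta_mx i ord0) f x.

Definition mx_of_rows (R : realType) (rows : seq (seq R)) : 'M[R]_3 :=
  \matrix_(i < 3, j < 3) (nth [::] rows i)`_j.

Definition Mtilde (R : realType) (L : R) (beta : nat -> R) (k : nat) : 'M[R]_3 :=
  mx_of_rows
    [:: [:: 0;                 0;                - (1 / 2) * beta k];
        [:: 0;                 0;                1 / 2 * beta k    ];
        [:: - (1 / 2) * beta k; 1 / 2 * beta k;   1 / (2 * L)       ]].

Definition Ntilde (R : realType) (L : R) (beta : nat -> R) (k : nat) : 'M[R]_3 :=
  mx_of_rows
    [:: [:: 0;                       0;              - (1 / 2) * (1 + beta k)];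
        [:: 0;                       0;              1 / 2 * beta k          ];
        [:: - (1 / 2) * (1 + beta k); 1 / 2 * beta k; 1 / (2 * L)             ]].

Lemma mul3n_split (p : nat) : (3 * p = 2 * p + p)%N.
Proof. by rewrite mulSn addnC. Qed.

(* T (x) I_p.  [tensmx] returns a matrix of size 3 * p; the cast only retypes it
   (indices keep their value) so that it acts on stacked vectors col_mx xi w. *)
Definition kronI (R : realType) (p : nat) (T : 'M[R]_3) : 'M[R]_(2 * p + p) :=
  castmx (mul3n_split p, mul3n_split p) (tensmx T (1%:M : 'M[R]_p)).

Definition Mmx (R : realType) (p : nat) (L : R) (beta : nat -> R) (k : nat) :
  'M[R]_(2 * p + p) := kronI p (Mtilde L beta k).

Definition Nmx (R : realType) (p : nat) (L : R) (beta : nat -> R) (k : nat) :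
  'M[R]_(2 * p + p) := kronI p (Ntilde L beta k).

Definition trajectory (R : realType) (p : nat) (A : nat -> 'M[R]_(2 * p))
    (B : nat -> 'M[R]_(2 * p, p)) (xi : nat -> 'cV[R]_(2 * p))
    (w : nat -> 'cV[R]_p) : Prop :=
  forall k, xi k.+1 = A k *m xi k + B k *m w k.

Definition dissipation_mx (R : realType) (p : nat) (A : nat -> 'M[R]_(2 * p))
    (B : nat -> 'M[R]_(2 * p, p)) (P : nat -> 'M[R]_(2 * p)) (k : nat) :
    'M[R]_(2 * p + p) :=
  block_mx ((A k)^T *m P k.+1 *m A k - P k) ((A k)^T *m P k.+1 *m B k)
           ((B k)^T *m P k.+1 *m A k)       ((B k)^T *m P k.+1 *m B k).

Definition storage (R : realType) (p : nat) (P : nat -> 'M[R]_(2 * p)) (k : nat)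
    (xi : 'cV[R]_(2 * p)) : R := qform (P k) xi.

Definition supply_mx (R : realType) (p : nat) (L : R) (beta mu : nat -> R)
    (k : nat) : 'M[R]_(2 * p + p) :=
  mu k *: Mmx p L beta k + (mu k.+1 - mu k) *: Nmx p L beta k.

Definition supply (R : realType) (p : nat) (L : R) (beta mu : nat -> R) (k : nat)
    (xi : 'cV[R]_(2 * p)) (w : 'cV[R]_p) : R :=
  qform (supply_mx p L beta mu k) (col_mx xi w).

(* Main.v *)
Require Import Defs.
From HB Require Import structures.
From mathcomp Require Import all_boot all_order all_algebra.
From mathcomp Require Import lra.
From mathcomp Require Import all_classical all_reals all_analysis.

Set Implicit Arguments.
Unset Strict Implicit.
Unset Printing Implicit Defensive.

Import Order.TTheory GRing.Theory Num.Theory.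
Import numFieldNormedType.Exports.

Local Open Scope ring_scope.

(** The quadratic form of the block matrix of the LMI at the stacked vector
    (xi, w) is the increase of the storage function in one step of the system
    (lemma [dissipation_qform]); so testing the LMI at the stacked vectors of a
    trajectory is the dissipation inequality
    V_(k+1) - V_k <= S_k.

    If moreover S_k is at most the decrease of the weighted gap
    mu_k * (f (x_k) - f_star), then the energy
    mu_k * (f (x_k) - f_star) + V_k
    does not increase with k, hence stays below its initial value.  As P_k is
    positive semidefinite, V_k is nonnegative and can be dropped; dividing by
    mu_k > 0 gives the bound. *)

Lemma qformB (R : realType) (n : nat) (M N : 'M[R]_n) (x : 'cV[R]_n) :
  qform (M - N) x = qform M x - qform N x.
Proof. by rewrite /qform mulmxBr mulmxBl !mxE. Qed.

(** Both sides expand, with y = A_k xi + B_k w, to y^T P_(k+1) y - xi^T P_k xi: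
    up to the term P_k, the block matrix is the congruence of P_(k+1) by the
    row block [A_k B_k], which sends (xi, w) to y. *)
Lemma dissipation_qform (R : realType) (p : nat)
    (A : nat -> 'M[R]_(2 * p)) (B : nat -> 'M[R]_(2 * p, p))
    (P : nat -> 'M[R]_(2 * p)) (k : nat) (xi : 'cV[R]_(2 * p)) (w : 'cV[R]_p) :
  qform (dissipation_mx A B P k) (col_mx xi w)
  = storage P k.+1 (A k *m xi + B k *m w) - storage P k xi.
Proof.
have blockE : dissipation_mx A B P k
    = (row_mx (A k) (B k))^T *m P k.+1 *m row_mx (A k) (B k)
      - block_mx (P k) 0 0 0.
  rewrite tr_row_mx mul_col_mx mul_col_row opp_block_mx add_block_mx.
  by rewrite !oppr0 !addr0.
rewrite blockE qformB /storage /qform; congr (_ - _).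
  by rewrite -mul_row_col trmx_mul !mulmxA.
by rewrite tr_col_mx mul_row_block !mulmx0 !addr0 mul_row_col mul0mx addr0.
Qed.

(** The LMI tested at (xi_k, w_k). *)
Lemma dissipation_inequality (R : realType) (p : nat)
    (A : nat -> 'M[R]_(2 * p)) (B : nat -> 'M[R]_(2 * p, p))
    (L : R) (beta : nat -> R) (P : nat -> 'M[R]_(2 * p)) (mu : nat -> R)
    (xi : nat -> 'cV[R]_(2 * p)) (w : nat -> 'cV[R]_p) (k : nat) :
  nsdmx (dissipation_mx A B P k
         - mu k *: Mmx p L beta k
         - (mu k.+1 - mu k) *: Nmx p L beta k) ->
  trajectory A B xi w ->
  storage P k.+1 (xi k.+1) - storage P k (xi k)
    <= supply L beta mu k (xi k) (w k).
Proof.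
move=> [_ lmi] traj; have := lmi (col_mx (xi k) (w k)).
by rewrite -addrA -opprD qformB subr_le0 dissipation_qform -traj.
Qed.

(** Adding the two hypotheses at each step shows that g + V is nonincreasing. *)
Lemma energy_le_initial (R : realType) (V S g : nat -> R) :
  (forall k, V k.+1 - V k <= S k) ->
  (forall k, S k <= g k - g k.+1) ->
  forall k, g k + V k <= g 0%N + V 0%N.
Proof.
move=> dissip supply_le; elim=> [//|k]; apply: le_trans.
by have := le_trans (dissip k) (supply_le k); lra.
Qed.

Theorem theorem9 (R : realType) (p : nat)
    (A : nat -> 'M[R]_(2 * p)) (B : nat -> 'M[R]_(2 * p, p))
    (L : R) (beta : nat -> R)
    (P : nat -> 'M[R]_(2 * p)) (mu : nat -> R)
    (L_gt0 : 0 < L)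
    (P_psd : forall k, psdmx (P k))
    (mu_ge0 : forall k, 0 <= mu k)
    (mu_nondecreasing : nondecreasing_seq mu)
    (lmi : forall k,
       nsdmx (dissipation_mx A B P k
              - mu k *: Mmx p L beta k
              - (mu k.+1 - mu k) *: Nmx p L beta k)) :
  (forall (xi : nat -> 'cV[R]_(2 * p)) (w : nat -> 'cV[R]_p),
     trajectory A B xi w ->
     forall k, storage P k.+1 (xi k.+1) - storage P k (xi k)
               <= supply L beta mu k (xi k) (w k))
  /\
  (forall (f : 'cV[R]_p -> R) (xstar : 'cV[R]_p),
     (forall x, differentiable f x) ->
     gradient f xstar = 0 ->
     forall (xi : nat -> 'cV[R]_(2 * p)) (w x : nat -> 'cV[R]_p),
       trajectory A B xi w ->
       (forall k, supply L beta mu k (xi k) (w k)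
                  <= mu k * (f (x k) - f xstar)
                     - mu k.+1 * (f (x k.+1) - f xstar)) ->
       forall k, 0 < mu k ->
         f (x k) - f xstar
         <= (mu 0%N * (f (x 0%N) - f xstar) + storage P 0 (xi 0%N)) / mu k).
Proof.
split=> [xi w traj k|f xstar _ _ xi w x traj supply_le k muk_gt0].
  exact: dissipation_inequality (lmi k) traj.
have energy := energy_le_initial
  (fun j => dissipation_inequality (lmi j) traj) supply_le k.
rewrite ler_pdivlMr // mulrC; apply: le_trans energy.
by rewrite lerDl; exact: (P_psd k).2.
Qed.
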